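(* Assume that $\tau$ is a topology on $X$ such that each functional $\mathcal{R}_k\colon X\to[0,+\infty]$, $1\le k\le n$, is sequentially coercive and lower semi-continuous with respect to $\tau$. Let $F\in\mathcal{F}(\tau)$ and $y\in Y$, and assume that there exists $x_0\in\mathcal{D}$ such that $F(x_0)=y$. Let moreover $\{y^{(l)}\}_{l\in\mathbb{N}}\subset Y$ be any sequence converging to $y$ with respect to $\sigma$, let $\{F^{(l)}\}_{l\in\mathbb{N}}\subset\mathcal{F}(\tau)$ be any sequence converging to $F$ with respect to $\tau$, and let $\{\alpha^{(l)}\}_{l\in\mathbb{N}}\subset\mathbb{R}_{\ge 0}^n\setminus\{0\}$. Let $L:=\{y\}\cup\{y^{(l)}\}_{l\in\mathbb{N}}$ and \[ K:=\{x\in X : \mathcal{R}_k(x)\le\mathcal{R}_k(x_0)+1\text{ for some }1\le k\le n\}. \] Assume that \[ \frac{\mathcal{S}(y,y^{(l)})+d_{K,L}(F^{(l)},F)}{\sum_k\alpha_k^{(l)}}\to 0\qquad\text{and}\qquad\sum_k\alpha_k^{(l)}\to 0 \] as $l\to\infty$, and for every $l$ let \[ x^{(l)}\in\operatorname{arg\,min}\{\mathcal{T}(x;\alpha^{(l)},y^{(l)},F^{(l)}) : x\in X\}. \] Consider any sub-sequence, again indexed by $l$, for which the vectors \[ \bar\alpha^{(l)}:=\frac{\alpha^{(l)}}{\sum_k\alpha_k^{(l)}}\in[0,1]^n \] converge to some $\bar\alpha\in[0,1]^n$ (such a sub-sequence exists because of the boundedness of the sequence). Then every sub-sequence of (this sub-sequence)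 $\{x^{(l)}\}_{l}$ has a further sub-sequence that $\tau$-converges to some $x^\dagger\in X$ satisfying $F(x^\dagger)=y$ and, in addition, \[ \sum_k\bar\alpha_k\mathcal{R}_k(x^\dagger)\le\inf\Bigl\{\sum_k\bar\alpha_k\mathcal{R}_k(x) : x\in\mathcal{D},\ F(x)=y\Bigr\}. \]
   Context: Setting: $X$ and $Y$ are sets, $n\ge 1$, $\mathcal{R}_k\colon X\to[0,+\infty]$ for $1\le k\le n$, and $\mathcal{S}\colon Y\times Y\to\mathbb{R}_{\ge 0}$ satisfies $\mathcal{S}(y,z)=0$ if and only if $y=z$. For $\alpha\in\mathbb{R}_{\ge 0}^n$, $y\in Y$ and $F\colon X\to Y$, the Tikhonov functional is \[ \mathcal{T}(x;\alpha,y,F)=\mathcal{S}(F(x),y)+\sum_{k=1}^n\alpha_k\mathcal{R}_k(x), \] with the convention $\alpha_k\mathcal{R}_k(x):=0$ if $\alpha_k=0$ and $\mathcal{R}_k(x)=+\infty$ (the same convention applies to $\bar\alpha_k\mathcal{R}_k(x)$). Topology $\sigma$ on $Y$: the topology induced by the uniformity generated by the pseudo-metrics $d^{(z)}(y,\tilde y):=|\mathcal{S}(z,y)-\mathcal{S}(z,\tilde y)|$, $z\in Y$. Thus $y^{(l)}\to y$ with respect to $\sigma$ if and only if $\mathcal{S}(z,y^{(l)})\to\mathcal{S}(z,y)$ for every $z\in Y$. Sequential coercivity of $\mathcal{R}_k$ with respect to $\tau$ means that every sequence in $X$ on which $\mathcal{R}_k$ is bounded (from above by a finite constant) has a $\tau$-convergent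 sub-sequence (with limit in $X$). Joint domain: $\mathcal{D}:=\{x\in X : \mathcal{R}_k(x)<+\infty \text{ for all } 1\le k\le n\}$. It is assumed throughout that $\mathcal{D}\ne\emptyset$. Class $\mathcal{F}(\tau)$: the set of all mappings $F\colon X\to Y$ such that (i) the mapping $(x,y)\mapsto\mathcal{S}(F(x),y)$ is sequentially lower semi-continuous with respect to the product topology $\tau\times\sigma$ on $X\times Y$; and (ii) for every $x\in X$ and every $y\in Y$ there exists a sequence $\{x^{(l)}\}_{l\in\mathbb{N}}\subset\mathcal{D}$ converging to $x$ with respect to $\tau$ such that $\mathcal{R}_k(x^{(l)})\to\mathcal{R}_k(x)$ for every $1\le k\le n$ and $\mathcal{S}(F(x^{(l)}),y)\to\mathcal{S}(F(x),y)$. Convergence of mappings: for $K\subset X$, $L\subset Y$ and $F,G\colon X\to Y$ let $d_{K,L}(F,G):=\sup\{|\mathcal{S}(F(x),z)-\mathcal{S}(G(x),z)| : x\in K,\ z\in L\}$. A sequence $F^{(l)}\colon X\to Y$ converges to $F\colon X\to Y$ with respect to $\tau$ if $d_{K,L}(F^{(l)},F)\to 0$ whenever $K\subset X$ is sequentially $\tau$-compact and $L\subset Y$ is sequentially $\sigma$-compact. *)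

(* Defs.v *)
From HB Require Import structures.
From mathcomp Require Import all_boot all_order all_algebra.
From mathcomp Require Import all_classical all_reals all_analysis.
Set Implicit Arguments.
Unset Strict Implicit.
Unset Printing Implicit Defensive.
Import Order.TTheory GRing.Theory Num.Theory.
Import numFieldNormedType.Exports.
Local Open Scope classical_set_scope.
Local Open Scope ring_scope.

Section sequential.
Context {R : realType} {T : topologicalType}.

Definition seq_compact (A : set T) : Prop :=
  forall u : nat -> T, (forall l, A (u l)) ->
  exists2 phi : nat -> nat, increasing_seq phi &
  exists2 x, A x & u \o phi @ \oo --> x.

Definition seq_lsc (f : T -> \bar R) : Prop :=
  forall (u : nat -> T) (x : T), u @ \oo --> x ->
  (f x <= limn_einf (f \o u))%E.

Definition seq_coercive (f : T -> \bar R) : Prop :=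
  forall (u : nat -> T) (c : R), (forall l, (f (u l) <= c%:E)%E) ->
  exists2 phi : nat -> nat, increasing_seq phi &
  exists x : T, u \o phi @ \oo --> x.

End sequential.

Definition argmin {R : realType} {T : Type} (f : T -> \bar R) : set T :=
  [set x | forall x', (f x <= f x')%E].

(* [initial_topology (S z)] carries the uniformity of the pseudo-metric
   d^(z)(y, y') = `|S z y - S z y'|, and [sup_topology] is the uniform space
   whose uniformity is generated by all of these. *)
Definition sigma {R : realType} {Y : choiceType} (S : Y -> Y -> R) :
    uniformType :=
  @sup_topology Y Y
    (fun z => Uniform.class (initial_topology (S z : Y -> R^o))).

Lemma sigma_ballE {R : realType} {Y : choiceType} (S : Y -> Y -> R)
    (z y y' : Y) (e : R) :
  @ball R (initial_topology (S z : Y -> R^o)) y e y' =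
  (`|S z y - S z y'| < e) :> Prop.
Proof. by []. Qed.

Lemma cvg_sigmaE {R : realType} {Y : choiceType} (S : Y -> Y -> R)
    (u : nat -> Y) (y : Y) :
  (u : nat -> sigma S) @ \oo --> (y : sigma S) <->
  forall z, S z (u l) @[l --> \oo] --> S z y.
Proof.
pose Tc z := Uniform.class (initial_topology (S z : Y -> R^o)).
have supE := @cvg_sup Y Y Tc (u @ \oo) y _.
split=> [/supE uy z A nA|uy].
  exact: (uy z _ (@initial_continuous Y R^o (S z) y A nA)).
apply/supE => z A /= [_ [[B oB <-] By sBA]].
have nB : nbhs (S z y) B by exact: open_nbhs_nbhs.
have := uy z B nB; rewrite !nbhs_filterE => uB.
near=> l; apply: sBA => /=; near: l; exact: uB.
Unshelve. all: by end_near.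
Qed.

Section tikhonov.
Context {R : realType} {X : topologicalType} {Y : choiceType} {n : nat}.
Variables (Rk : 'I_n -> X -> \bar R) (S : Y -> Y -> R).

(* In [\bar R], 0 * +oo = 0. *)
Definition penalty (alpha : 'rV[R]_n) (x : X) : \bar R :=
  (\sum_(k < n) (alpha ord0 k)%:E * Rk k x)%E.

Definition tikhonov (alpha : 'rV[R]_n) (y : Y) (F : X -> Y) (x : X) : \bar R :=
  ((S (F x) y)%:E + penalty alpha x)%E.

Definition joint_domain : set X := [set x | forall k, (Rk k x < +oo)%E].

Definition classF (F : X -> Y) : Prop :=
  seq_lsc (fun p : X * sigma S => (S (F p.1) p.2)%:E) /\
  forall (x : X) (y : Y), exists u : nat -> X,
    [/\ forall l, joint_domain (u l),
        u @ \oo --> x,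
        forall k, Rk k (u l) @[l --> \oo] --> Rk k x &
        S (F (u l)) y @[l --> \oo] --> S (F x) y].

(* The supremum is taken in [0, +oo]: 0 is adjoined because the library's
   supremum of the empty set is -oo. *)
Definition dist_on (K : set X) (L : set Y) (F G : X -> Y) : \bar R :=
  ereal_sup (0%E |` [set `|S (F x) z - S (G x) z|%:E | x in K & z in L]).

Definition cvg_map (F_ : nat -> X -> Y) (F : X -> Y) : Prop :=
  forall (K : set X) (L : set Y),
  seq_compact K -> seq_compact (L : set (sigma S)) ->
  dist_on K L (F_ l) F @[l --> \oo] --> 0%E.

End tikhonov.

Definition alpha_sum {R : realType} {n : nat} (alpha : 'rV[R]_n) : R :=
  \sum_(k < n) alpha ord0 k.

Definition alpha_bar {R : realType} {n : nat} (alpha : 'rV[R]_n) : 'rV[R]_n :=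
  (alpha_sum alpha)^-1 *: alpha.

(* Main.v *)
Require Import Defs.
From mathcomp Require Import all_boot all_order all_algebra.
From mathcomp Require Import all_classical all_reals all_analysis.
Set Implicit Arguments.
Unset Strict Implicit.
Unset Printing Implicit Defensive.
Import Order.TTheory GRing.Theory Num.Theory.
Import numFieldNormedType.Exports.
Local Open Scope classical_set_scope.
Local Open Scope ring_scope.

(** Let [q_l] be the quotient (S(y, y_l) + d_{K,L}(F_l, F)) / sum_k alpha_l,k of
    the hypotheses, so that [q_l] tends to 0.  If F x = y and x is in K, comparing
    the minimizer x_l with x and replacing F_l by F at the cost d_{K,L}(F_l, F)
    gives, after division by sum_k alpha_l,k ([penalty_min_le]),

      sum_k abar_l,k R_k(x_l) <= q_l + sum_k abar_l,k R_k(x).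

    Taken at x = x0, and since the normalized weights have sum 1, this prevents
    R_k(x_l) > R_k(x0) + 1 from holding for all k at once as soon as q_l < 1: the
    minimizers are eventually in K ([minimizers_near_sublevel]).  One and the same
    R_k is therefore bounded along infinitely many of them, and its coercivity
    gives a convergent subsequence ([seq_coercive_pigeonhole]).

    Once x_l is in K, F_l can also be replaced by F in the residual of x_l, so that
    S(F x_l, y_l) is bounded by quantities that vanish together with q_l and
    sum_k alpha_l,k ([residual_min_le]); lower semicontinuity then forces
    F xdag = y ([limit_solution]).

    Finally, passing to the lower limit in the displayed inequality, with lower
    limits superadditive and compatible with convergent weights
    ([penalty_seq_lsc]), yields the minimality of xdag among the solutions in K.
    A solution x outside K is no competitor: all its R_k(x) exceed R_k(x0) + 1,
    so its weighted penalty exceeds that of x0 ([limit_penalty_le]). *)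

(** * Subsequences *)

Lemma increasing_seq_comp (f g : nat -> nat) :
  increasing_seq f -> increasing_seq g -> increasing_seq (f \o g).
Proof. by move=> fi gi m n /=; rewrite fi; exact: gi. Qed.

Lemma increasing_seq_addr (N : nat) : increasing_seq (addn^~ N).
Proof. by move=> m n; rewrite !leEnat leq_add2r. Qed.

Lemma increasing_seq_cvgny (f : nat -> nat) :
  increasing_seq f -> f @ \oo --> \oo.
Proof.
move=> fi; apply/cvgnyPge => A; near=> l.
suff lef m : (m <= f m)%N.
  by apply: leq_trans (lef l); near: l; exact: nbhs_infty_ge.
elim: m => // m /leq_ltn_trans; apply.
by have /increasing_seqP := fi; apply.
Unshelve. all: by end_near. Qed.

Lemma cvg_subseq (T : Type) (G : set_system T) (u : nat -> T) (f : nat -> nat) :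
  increasing_seq f -> u @ \oo --> G -> u (f l) @[l --> \oo] --> G.
Proof. by move=> /increasing_seq_cvgny foo; exact: (cvg_comp f u foo). Qed.

Lemma near_subseq (P : nat -> Prop) (f : nat -> nat) :
  increasing_seq f -> (\forall l \near \oo, P l) ->
  \forall l \near \oo, P (f l).
Proof. by move=> /increasing_seq_cvgny foo /foo. Qed.

Lemma cvg_rV (R : realType) (n : nat) (u : nat -> 'rV[R]_n) (v : 'rV[R]_n) :
  (forall k, u l ord0 k @[l --> \oo] --> v ord0 k) -> u @ \oo --> v.
Proof.
move=> uv; apply/cvg_ballP => e e0.
have : \forall l \near \oo, forall k, ball (v ord0 k) e (u l ord0 k).
  by apply: filter_forall => k; move/cvg_ballP: (uv k); exact.
by apply: filterS => l ul; split=> // i j; rewrite (ord1 i).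
Qed.

Lemma cvg_coord (R : realType) (n : nat) (u : nat -> 'rV[R]_n) (v : 'rV[R]_n) k :
  u @ \oo --> v -> u l ord0 k @[l --> \oo] --> v ord0 k.
Proof.
by move=> uv; exact: (cvg_comp _ _ uv (@coord_continuous _ _ _ ord0 k v)).
Qed.

Lemma cvg_rV_ge0 (R : realType) (n : nat) (u : nat -> 'rV[R]_n) (v : 'rV[R]_n) k :
  (forall l, 0 <= u l ord0 k) -> u @ \oo --> v -> 0 <= v ord0 k.
Proof.
move=> u0 /(@cvg_coord _ _ _ _ k) uv; rewrite -(cvg_lim _ uv)//.
by apply: limr_ge; [apply: cvgP uv|exact: nearW].
Qed.

Lemma rV_bolzano_weierstrass (R : realType) (n : nat) (u : nat -> 'rV[R]_n) :
  (forall l k, 0 <= u l ord0 k <= 1) ->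
  exists2 phi : nat -> nat, increasing_seq phi &
  exists2 v : 'rV[R]_n, (forall k, 0 <= v ord0 k <= 1) &
    u (phi l) @[l --> \oo] --> v.
Proof.
move=> u01.
have [phi phii cphi] : exists2 phi : nat -> nat, increasing_seq phi &
    forall k, cvgn (fun l => u (phi l) ord0 k).
  (* extract successively, one coordinate at a time *)
  suff [phi phii cphi] : exists2 phi : nat -> nat, increasing_seq phi &
      forall k : 'I_n, (k < n)%N -> cvgn (fun l => u (phi l) ord0 k).
    by exists phi => // k; exact: cphi.
  elim: {3}n => [|m [phi phii cphi]]; first by exists id.
  have [mn|nm] := ltnP m n; last first.
    by exists phi => // k _; apply: cphi; exact: leq_trans (ltn_ord k) nm.
  have [|psi psii cpsi] :=
      @bolzano_weierstrass R (fun l => u (phi l) ord0 (Ordinal mn)).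
    exists 1; split; first exact: real1.
    move=> x x1 l _ /=; have /andP[u0 u1] := u01 (phi l) (Ordinal mn).
    by rewrite ger0_norm//; exact: le_trans (ltW x1).
  exists (phi \o psi); first exact: increasing_seq_comp.
  move=> k; rewrite ltnS leq_eqVlt => /orP[/eqP km|km].
    by rewrite (_ : k = Ordinal mn)//; exact: val_inj.
  by have /cvg_ex[c /(cvg_subseq psii) uc] := cphi k km; apply/cvg_ex; exists c.
exists phi => //; exists (\row_k limn (fun l => u (phi l) ord0 k)).
  move=> k; rewrite mxE; apply/andP; split.
    apply: limr_ge; first exact: cphi.
    by apply: nearW => l; have /andP[] := u01 (phi l) k.
  apply: limr_le; first exact: cphi.
  by apply: nearW => l; have /andP[] := u01 (phi l) k.
by apply: cvg_rV => k; rewrite mxE; exact: cphi.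
Qed.

(** If every late term of a sequence is in a sublevel set of one of finitely
    many coercive functionals, then by the pigeonhole principle infinitely many
    terms are in a sublevel set of the same functional. *)
Lemma seq_coercive_pigeonhole (R : realType) (X : topologicalType) (n : nat)
    (Rk : 'I_n -> X -> \bar R) (c : 'I_n -> R) (u : nat -> X) :
  (forall k, seq_coercive (Rk k)) ->
  (\forall l \near \oo, exists k, (Rk k (u l) <= (c k)%:E)%E) ->
  exists2 chi : nat -> nat, increasing_seq chi &
  exists x : X, u (chi l) @[l --> \oo] --> x.
Proof.
move=> Rk_coercive [N _ uc].
have /choice[kappa ukappa] (l : nat) : exists k, (Rk k (u (l + N)%N) <= (c k)%:E)%E.
  by apply: uc => /=; exact: leq_addl.
have [|k [A Aoo Ak]] := @finite_range_cst_subsequence _ kappa.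
  exact: finite_finset.
have /= [|f [fi _ Af]] := infinite_increasing_seq_wf _ Aoo 0%N.
  by move=> m; apply: sub_finite_set (finite_II m.+1) => p /=.
have [|g gi [x ux]] := Rk_coercive k (fun l => u (f l + N)%N) (c k).
  by move=> l; rewrite -(Ak (f l)).1.
exists (addn^~ N \o (f \o g)); last by exists x.
exact: increasing_seq_comp (@increasing_seq_addr N) (increasing_seq_comp fi gi).
Qed.

(** * Lower limits in the extended reals *)

Section limn_einf.
Context {R : realType}.
Implicit Types u v : (\bar R)^nat.
Local Open Scope ereal_scope.

Lemma le_limn_einf u v :
  (\forall l \near \oo, u l <= v l) -> limn_einf u <= limn_einf v.
Proof.
move=> [N _ uv]; rewrite !limn_einf_lim.
apply: lee_lim; [exact: is_cvg_einfs|exact: is_cvg_einfs|].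
near=> m; apply: le_ereal_inf_tmp => _ [l /= ml <-].
apply: (@le_trans _ _ (u l)); first by apply: ereal_inf_lbound; exists l.
by apply: uv => /=; apply: leq_trans ml; near: m; exact: nbhs_infty_ge.
Unshelve. all: by end_near. Qed.

Lemma limn_einf_le_cvg u v (b : \bar R) :
  (\forall l \near \oo, u l <= v l) -> v @ \oo --> b -> limn_einf u <= b.
Proof. by move=> /le_limn_einf uv /cvg_limn_einf_sup[<- _]. Qed.

Lemma lee_cvg u v (a b : \bar R) : u @ \oo --> a -> v @ \oo --> b ->
  (forall l, u l <= v l) -> a <= b.
Proof.
move=> ua vb uv; rewrite -(cvg_lim _ ua)// -(cvg_lim _ vb)//.
by apply: lee_lim; [apply: cvgP ua|apply: cvgP vb|exact: nearW].
Qed.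

Lemma einfs_ge0 u m : (forall l, 0 <= u l) -> 0 <= einfs u m.
Proof. by move=> u0; apply: le_ereal_inf_tmp => _ [l _ <-]. Qed.

Lemma limn_einf_ge0 u : (forall l, 0 <= u l) -> 0 <= limn_einf u.
Proof.
move=> u0; rewrite limn_einf_lim; apply: lime_ge; first exact: is_cvg_einfs.
by apply: nearW => m; exact: einfs_ge0.
Qed.

Lemma cvg_einfs_limn u : einfs u @ \oo --> limn_einf u.
Proof. by rewrite limn_einf_lim; exact: is_cvg_einfs. Qed.
Arguments cvg_einfs_limn : clear implicits.

Lemma limn_einfD_ge u v : (forall l, 0 <= u l) -> (forall l, 0 <= v l) ->
  limn_einf u + limn_einf v <= limn_einf (fun l => u l + v l).
Proof.
move=> u0 v0; have uvD : limn_einf u +? limn_einf v.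
  by apply: ge0_adde_def; rewrite inE; exact: limn_einf_ge0.
apply: lee_cvg _ (cvg_einfs_limn _) _.
  exact: cvgeD uvD (cvg_einfs_limn u) (cvg_einfs_limn v).
move=> m; apply: le_ereal_inf_tmp => _ [l /= ml <-].
by apply: leeD; apply: ereal_inf_lbound; exists l.
Qed.

Lemma limn_einf_sum_ge (n : nat) (u : 'I_n -> (\bar R)^nat) :
  (forall k l, 0 <= u k l) ->
  \sum_(k < n) limn_einf (u k) <= limn_einf (fun l => \sum_(k < n) u k l).
Proof.
elim: n u => [|n IH] u u0.
  by rewrite big_ord0; apply: limn_einf_ge0 => l; rewrite big_ord0.
rewrite big_ord_recl [leRHS](_ : _ = limn_einf (fun l =>
    u ord0 l + \sum_(k < n) u (lift ord0 k) l)); last first.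
  by congr limn_einf; apply/funext => l; rewrite big_ord_recl.
apply: le_trans (limn_einfD_ge _ _) => //; last first.
  by move=> l; exact: sume_ge0.
by apply: leeD => //; apply: IH => k l.
Qed.

(** When the weights tend to 0, the left-hand side vanishes even if the lower
    limit of [u] is +oo. *)
Lemma limn_einfM_ge (a_ : nat -> R) (a : R) u :
  (forall l, 0 <= a_ l)%R -> a_ @ \oo --> a -> (forall l, 0 <= u l) ->
  a%:E * limn_einf u <= limn_einf (fun l => (a_ l)%:E * u l).
Proof.
move=> a_0 a_a u0.
have au0 l : 0 <= (a_ l)%:E * u l by rewrite mule_ge0// lee_fin.
have [->|a_neq0] := eqVneq a 0%R; first by rewrite mul0e limn_einf_ge0.
have aeinf : einfs (EFin \o a_) @ \oo --> a%:E.
  by apply: cvg_einfs; apply/cvg_EFin => //; exact: nearW.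
have aM : a%:E *? limn_einf u.
  by rewrite mule_defE eqe (negPf a_neq0)/= andbF.
apply: lee_cvg _ (cvg_einfs_limn _) _.
  exact: cvgeM aM aeinf (cvg_einfs_limn u).
move=> m; apply: le_ereal_inf_tmp => _ [l /= ml <-].
apply: lee_pmul; [apply: einfs_ge0 => i /=|exact: einfs_ge0| |].
- by rewrite lee_fin.
- by apply: ereal_inf_lbound; exists l.
- by apply: ereal_inf_lbound; exists l.
Qed.

End limn_einf.

(** * The penalty *)

Section penalty.
Context {R : realType} {X : topologicalType} {n : nat}.
Variable Rk : 'I_n -> X -> \bar R.
Hypothesis Rk_ge0 : forall k x, (0 <= Rk k x)%E.
Implicit Types (a : 'rV[R]_n) (x : X).

Lemma penalty_ge0 a x :
  (forall k, 0 <= a ord0 k) -> (0 <= penalty Rk a x)%E.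
Proof. by move=> a0; apply: sume_ge0 => k _; rewrite mule_ge0// lee_fin. Qed.

Lemma joint_domain_fin_num x k : joint_domain Rk x -> Rk k x \is a fin_num.
Proof. by move=> /(_ k) xD; rewrite ge0_fin_numE. Qed.

Lemma penalty_fin a x : joint_domain Rk x ->
  penalty Rk a x = (\sum_(k < n) a ord0 k * fine (Rk k x))%:E.
Proof.
move=> xD; rewrite -sumEFin; apply: eq_bigr => k _.
by rewrite EFinM fineK// joint_domain_fin_num.
Qed.

(** If every functional grows by at least 1, then so does every penalty whose
    weights have sum 1. *)
Lemma penalty_add1_le a x x' : (forall k, 0 <= a ord0 k) -> alpha_sum a = 1 ->
  (forall k, (Rk k x + 1 <= Rk k x')%E) ->
  (penalty Rk a x + 1 <= penalty Rk a x')%E.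
Proof.
move=> a0 a1 xx'.
have -> : (penalty Rk a x + 1 = \sum_(k < n) (a ord0 k)%:E * (Rk k x + 1))%E.
  rewrite -[in LHS]a1 -sumEFin -big_split/=; apply: eq_bigr => k _.
  by rewrite ge0_muleDr// mule1.
by apply: lee_sum => k _; apply: lee_wpmul2l => //; rewrite lee_fin.
Qed.

Lemma cvg_penalty (a_ : nat -> 'rV[R]_n) a x : joint_domain Rk x ->
  a_ @ \oo --> a -> penalty Rk (a_ l) x @[l --> \oo] --> penalty Rk a x.
Proof.
move=> xD a_a; rewrite penalty_fin//; under eq_fun do rewrite penalty_fin//.
apply/cvg_EFin; first exact: nearW.
apply: (cvg_big (op := +%R)) => [|k _]; first exact: add_continuous.
apply: cvgMr_tmp.
exact: cvg_coord.
Qed.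

(** The penalty is sequentially lower semicontinuous jointly in the weights and
    the point. *)
Lemma penalty_seq_lsc (a_ : nat -> 'rV[R]_n) a (u : nat -> X) x :
  (forall k, seq_lsc (Rk k)) -> (forall l k, 0 <= a_ l ord0 k) ->
  a_ @ \oo --> a -> u @ \oo --> x ->
  (penalty Rk a x <= limn_einf (fun l => penalty Rk (a_ l) (u l)))%E.
Proof.
move=> Rk_lsc a_0 a_a ux.
have a0 k : 0 <= a ord0 k by exact: cvg_rV_ge0 a_a.
apply: le_trans; last first.
  by apply: limn_einf_sum_ge => k l; rewrite mule_ge0// lee_fin.
apply: lee_sum => k _; apply: le_trans; last first.
  by apply: limn_einfM_ge (cvg_coord a_a) _.
by apply: lee_wpmul2l; [rewrite lee_fin|exact: Rk_lsc].
Qed.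

End penalty.

(** * Normalized weights *)

Section alpha_bar.
Context {R : realType} {n : nat} (a : 'rV[R]_n).
Hypothesis a_ge0 : forall k, 0 <= a ord0 k.

Lemma alpha_sum_gt0 : a != 0 -> 0 < alpha_sum a.
Proof.
move=> a0; rewrite lt_neqAle sumr_ge0// andbT eq_sym.
apply: contra_neq a0 => /eqP; rewrite psumr_eq0// => /allP ak.
apply/rowP => k; rewrite mxE; apply/eqP.
by apply: (implyP (ak k _)) => //; rewrite mem_index_enum.
Qed.

Hypothesis a_neq0 : a != 0.

Lemma alpha_bar_ge0 k : 0 <= alpha_bar a ord0 k.
Proof. by rewrite mxE mulr_ge0// invr_ge0 ltW// alpha_sum_gt0. Qed.

Lemma alpha_sum_bar : alpha_sum (alpha_bar a) = 1.
Proof.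
rewrite /alpha_sum; under eq_bigr do rewrite mxE.
by rewrite -mulr_sumr mulVf// gt_eqF// alpha_sum_gt0.
Qed.

Lemma alpha_bar_le1 k : alpha_bar a ord0 k <= 1.
Proof.
rewrite -alpha_sum_bar /alpha_sum (bigD1 k)//= lerDl sumr_ge0// => i _.
exact: alpha_bar_ge0.
Qed.

Lemma penalty_alpha_bar (X : topologicalType) (Rk : 'I_n -> X -> \bar R) x :
  (forall k x, (0 <= Rk k x)%E) ->
  penalty Rk (alpha_bar a) x = ((alpha_sum a)^-1%:E * penalty Rk a x)%E.
Proof.
move=> Rk_ge0; rewrite ge0_sume_distrr; last first.
  by move=> k _; rewrite mule_ge0// lee_fin.
by apply: eq_bigr => k _; rewrite mxE EFinM muleA.
Qed.

End alpha_bar.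

(** * A minimizer for one choice of data *)

Section minimizer.
Context {R : realType} {X : topologicalType} {Y : choiceType} {n : nat}.
Variables (Rk : 'I_n -> X -> \bar R) (S : Y -> Y -> R).
Hypothesis Rk_ge0 : forall k x, (0 <= Rk k x)%E.
Hypothesis S_ge0 : forall y z, 0 <= S y z.
Variables (K : set X) (L : set Y).

Lemma dist_on_ge0 (F G : X -> Y) : (0 <= dist_on S K L F G)%E.
Proof. by apply: ereal_sup_ubound; left. Qed.

Lemma le_dist_on (F G : X -> Y) x z : K x -> L z ->
  (`|S (F x) z - S (G x) z|%:E <= dist_on S K L F G)%E.
Proof.
by move=> Kx Lz; apply: ereal_sup_ubound; right; exists x => //; exists z.
Qed.

Lemma le_dist_onl (F G : X -> Y) x z : K x -> L z ->
  ((S (F x) z)%:E <= (S (G x) z)%:E + dist_on S K L F G)%E.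
Proof.
move=> Kx Lz; apply: le_trans (leeD (lexx _) (le_dist_on F G Kx Lz)).
by rewrite -EFinD lee_fin -lerBlDl ler_norm.
Qed.

Lemma le_dist_onr (F G : X -> Y) x z : K x -> L z ->
  ((S (G x) z)%:E <= (S (F x) z)%:E + dist_on S K L F G)%E.
Proof.
move=> Kx Lz; apply: le_trans (leeD (lexx _) (le_dist_on F G Kx Lz)).
by rewrite -EFinD lee_fin -lerBlDl distrC ler_norm.
Qed.

Variables (F Fl : X -> Y) (y yl : Y) (a : 'rV[R]_n) (xl : X).
Hypothesis a_ge0 : forall k, 0 <= a ord0 k.
Hypothesis a_neq0 : a != 0.
Hypothesis Lyl : L yl.
Hypothesis xl_min : argmin (tikhonov Rk S a yl Fl) xl.

(* the total perturbation: the error of the data plus that of the mapping *)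
Let noise : \bar R := ((S y yl)%:E + dist_on S K L Fl F)%E.
Let s := alpha_sum a.

Let s_gt0 : 0 < s. Proof. exact: alpha_sum_gt0. Qed.

Let noise_ge0 : (0 <= noise)%E.
Proof. by rewrite adde_ge0 ?lee_fin ?dist_on_ge0. Qed.

Lemma tikhonov_min_le x : K x -> F x = y ->
  (tikhonov Rk S a yl Fl xl <= noise + penalty Rk a x)%E.
Proof.
move=> Kx Fx; apply: le_trans (xl_min x) _; apply: leeD => //.
by rewrite /noise -Fx; exact: le_dist_onl.
Qed.

(** The basic estimate; only the competitor [x], not the minimizer [xl], has to be
    in [K]. *)
Lemma penalty_min_le x : K x -> F x = y ->
  (penalty Rk (alpha_bar a) xl <=
   noise * s^-1%:E + penalty Rk (alpha_bar a) x)%E.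
Proof.
move=> Kx Fx; rewrite !penalty_alpha_bar// muleC.
rewrite [(noise * _)%E]muleC -/s -ge0_muleDr ?penalty_ge0// muleC.
apply: lee_wpmul2l; first by rewrite lee_fin invr_ge0 ltW.
apply: le_trans (tikhonov_min_le Kx Fx).
by rewrite /tikhonov leeDr// lee_fin.
Qed.

(** A bound on the residual of the minimizer for the limit mapping [F]; here [xl]
    itself has to be in [K]. *)
Lemma residual_min_le x : K xl -> K x -> F x = y ->
  ((S (F xl) yl)%:E <= s%:E * (noise * s^-1%:E) +
    (s%:E * (noise * s^-1%:E) + s%:E * \sum_(k < n) Rk k x))%E.
Proof.
move=> Kxl Kx Fx.
have noiseE : (s%:E * (noise * s^-1%:E) = noise)%E.
  by rewrite muleCA -EFinM divff ?mule1// gt_eqF.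
rewrite noiseE; apply: le_trans (le_dist_onr Fl F Kxl Lyl) _.
rewrite addeC; apply: leeD; first by rewrite /noise leeDr// lee_fin.
have -> : (s%:E * \sum_(k < n) Rk k x = \sum_(k < n) s%:E * Rk k x)%E.
  by rewrite ge0_sume_distrr.
apply: le_trans (le_trans (tikhonov_min_le Kx Fx) _).
  by rewrite /tikhonov leeDl// penalty_ge0.
apply: leeD => //; apply: lee_sum => k _; apply: lee_wpmul2r => //.
rewrite lee_fin /s /alpha_sum (bigD1 k)//= lerDl; exact: sumr_ge0.
Qed.

End minimizer.

(** * Convergence to a penalty-minimizing solution *)

Section convergence.
Context {R : realType} {X : topologicalType} {Y : choiceType} {n : nat}.
Variables (Rk : 'I_n -> X -> \bar R) (S : Y -> Y -> R).
Hypothesis Rk_ge0 : forall k x, (0 <= Rk k x)%E.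
Hypothesis S_ge0 : forall y z, 0 <= S y z.
Hypothesis S_eq0 : forall y z, S y z = 0 -> y = z.
Variables (F : X -> Y) (x0 : X) (y : Y).
Hypothesis x0D : joint_domain Rk x0.
Hypothesis Fx0 : F x0 = y.
Variables (y_ : nat -> Y) (F_ : nat -> X -> Y) (alpha_ : nat -> 'rV[R]_n).
Hypothesis alpha_ge0 : forall l k, 0 <= alpha_ l ord0 k.
Hypothesis alpha_neq0 : forall l, alpha_ l != 0.
Variable x_ : nat -> X.
Hypothesis x_min :
  forall l, argmin (tikhonov Rk S (alpha_ l) (y_ l) (F_ l)) (x_ l).

Let L : set Y := [set y] `|` range y_.
Let K : set X := [set x | exists k, (Rk k x <= Rk k x0 + 1)%E].
Let q l : \bar R :=
  (((S y (y_ l))%:E + dist_on S K L (F_ l) F) * (alpha_sum (alpha_ l))^-1%:E)%E.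
Hypothesis q_cvg : q @ \oo --> 0%E.

Let Ly l : L (y_ l). Proof. by right; exists l. Qed.

Let notK x : ~ K x -> forall k, (Rk k x0 + 1 < Rk k x)%E.
Proof. by move=> nKx k; rewrite ltNge; apply/negP => le; apply: nKx; exists k. Qed.

Let Kx0 : K x0.
Proof.
(* [K] would be empty if there were no index; a nonzero weight provides one *)
have [[k _]|nok] := pselect (exists k : 'I_n, True).
  by exists k; rewrite leeDl//.
by have /rV0Pn[k _] := alpha_neq0 0; case: nok; exists k.
Qed.

Let penalty_le x l : K x -> F x = y ->
  (penalty Rk (alpha_bar (alpha_ l)) (x_ l) <=
   q l + penalty Rk (alpha_bar (alpha_ l)) x)%E.
Proof. by move=> Kx Fx; exact: penalty_min_le. Qed.

Lemma minimizers_near_sublevel : \forall l \near \oo, K (x_ l).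
Proof.
have : \forall l \near \oo, (q l < 1)%E.
  exact: (q_cvg (open_ereal_lt' lte01)).
apply: filterS => l q1; apply: contrapT => /notK x0x.
have xk k : (Rk k x0 + 1 <= Rk k (x_ l))%E by exact/ltW/x0x.
have a0 := alpha_bar_ge0 (alpha_ge0 l) (alpha_neq0 l).
have a1 := alpha_sum_bar (alpha_ge0 l) (alpha_neq0 l).
have := le_trans (penalty_add1_le Rk_ge0 a0 a1 xk) (penalty_le l Kx0 Fx0).
by rewrite penalty_fin// addeC leeD2rE// leNgt q1.
Qed.

Variables (abar : 'rV[R]_n) (xdag : X) (rho : nat -> nat).
Hypothesis rho_incr : increasing_seq rho.
Hypothesis abar_cvg : alpha_bar (alpha_ (rho l)) @[l --> \oo] --> abar.
Hypothesis xdag_cvg : x_ (rho l) @[l --> \oo] --> xdag.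

Lemma limit_solution :
  seq_lsc (fun p : X * sigma S => (S (F p.1) p.2)%:E) ->
  (y_ : nat -> sigma S) @ \oo --> (y : sigma S) ->
  alpha_sum (alpha_ l) @[l --> \oo] --> 0 ->
  F xdag = y.
Proof.
move=> S_lsc y_y total0.
have pair_cvg : (x_ (rho l), y_ (rho l) : sigma S) @[l --> \oo]
    --> (xdag, y : sigma S).
  exact: (cvg_pair xdag_cvg (cvg_subseq rho_incr y_y)).
have C_fin : (\sum_(k < n) Rk k x0)%E \is a fin_num.
  by apply/sum_fin_numP => k _ _; rewrite joint_domain_fin_num.
have total0E : (alpha_sum (alpha_ l))%:E @[l --> \oo] --> 0%E.
  by apply/cvg_EFin => //; exact: nearW.
(* the bound of [residual_min_le] with [x := x0] *)
pose b l : \bar R := ((alpha_sum (alpha_ l))%:E * q l +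
  ((alpha_sum (alpha_ l))%:E * q l +
   (alpha_sum (alpha_ l))%:E * \sum_(k < n) Rk k x0))%E.
have b0 : b @ \oo --> 0%E.
  have sq0 : ((alpha_sum (alpha_ l))%:E * q l)%E @[l --> \oo] --> 0%E.
    by rewrite -(mule0 (0 : \bar R)); exact: cvgeM.
  have sC0 : ((alpha_sum (alpha_ l))%:E * \sum_(k < n) Rk k x0)%E
      @[l --> \oo] --> 0%E.
    by have := cvgeZr C_fin total0E; rewrite mul0e.
  have D0 : ((0 : \bar R) +? 0)%E by rewrite fin_num_adde_defr.
  have := cvgeD D0 sq0 sC0; rewrite adde0 => /(_ _) sqC0.
  by have := cvgeD D0 sq0 sqC0; rewrite adde0 => /(_ _).
apply: S_eq0; apply/eqP; rewrite eq_le S_ge0 andbT -lee_fin.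
apply: le_trans (S_lsc _ _ pair_cvg) _.
apply: limn_einf_le_cvg (cvg_subseq rho_incr b0).
have := near_subseq rho_incr minimizers_near_sublevel.
by apply: filterS => l Kl /=; exact: residual_min_le.
Qed.

Lemma limit_penalty_le x : (forall k, seq_lsc (Rk k)) ->
  joint_domain Rk x -> F x = y ->
  (penalty Rk abar xdag <= penalty Rk abar x)%E.
Proof.
move=> Rk_lsc xD Fx.
have a_0 l k : 0 <= alpha_bar (alpha_ l) ord0 k by exact: alpha_bar_ge0.
have KP z : joint_domain Rk z -> K z -> F z = y ->
    (penalty Rk abar xdag <= penalty Rk abar z)%E.
  move=> zD Kz Fz.
  apply: le_trans (penalty_seq_lsc Rk_ge0 Rk_lsc _ abar_cvg xdag_cvg) _ => //.
  have := cvgeD (fin_num_adde_defr _ _) (cvg_subseq rho_incr q_cvg)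
    (cvg_penalty Rk_ge0 zD abar_cvg).
  rewrite add0e => /(_ _ isT) bcvg.
  apply: limn_einf_le_cvg bcvg.
  by apply: nearW => l; exact: penalty_le.
(* a solution outside [K] has a larger penalty than [x0] *)
have [Kx|/notK x0x] := pselect (K x); first exact: KP.
apply: le_trans (KP _ x0D Kx0 Fx0) _.
have abar0 k : 0 <= abar ord0 k by exact: cvg_rV_ge0 abar_cvg.
have abar1 : alpha_sum abar = 1.
  have : alpha_sum (alpha_bar (alpha_ (rho l))) @[l --> \oo] --> alpha_sum abar.
    apply: (cvg_big (op := +%R)) => [|k _]; first exact: add_continuous.
    exact: cvg_coord.
  under eq_cvg do rewrite alpha_sum_bar//.
  by move/(cvg_lim (@Rhausdorff R)); rewrite lim_cst.
apply: (@le_trans _ _ (penalty Rk abar x0 + 1)%E); first by rewrite leeDl.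
by apply: penalty_add1_le => // k; exact/ltW/x0x.
Qed.

End convergence.

Theorem theorem3p3 (R : realType) (X : topologicalType) (Y : choiceType)
    (n : nat) (n_ge1 : (1 <= n)%N)
    (Rk : 'I_n -> X -> \bar R) (Rk_ge0 : forall k x, (0 <= Rk k x)%E)
    (S : Y -> Y -> R) (S_ge0 : forall y z, 0 <= S y z)
    (S_eq0 : forall y z, S y z = 0 <-> y = z)
    (D_neq0 : joint_domain Rk !=set0)
    (Rk_coercive : forall k, seq_coercive (Rk k))
    (Rk_lsc : forall k, seq_lsc (Rk k))
    (F : X -> Y) (F_class : classF Rk S F) (y : Y)
    (x0 : X) (x0D : joint_domain Rk x0) (Fx0 : F x0 = y)
    (y_ : nat -> Y)
    (y_cvg : (y_ : nat -> sigma S) @ \oo --> (y : sigma S))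
    (F_ : nat -> X -> Y) (F__class : forall l, classF Rk S (F_ l))
    (F_cvg : cvg_map S F_ F)
    (alpha_ : nat -> 'rV[R]_n)
    (alpha_ge0 : forall l k, 0 <= alpha_ l ord0 k)
    (alpha_neq0 : forall l, alpha_ l != 0) :
  let L : set Y := [set y] `|` range y_ in
  let K : set X := [set x | exists k, (Rk k x <= Rk k x0 + 1)%E] in
  forall
    (quot_cvg : (((S y (y_ l))%:E + dist_on S K L (F_ l) F)
                  * ((alpha_sum (alpha_ l))^-1)%:E)%E @[l --> \oo] --> 0%E)
    (total_cvg : alpha_sum (alpha_ l) @[l --> \oo] --> 0)
    (x_ : nat -> X)
    (x_min : forall l, argmin (tikhonov Rk S (alpha_ l) (y_ l) (F_ l)) (x_ l)),
  (exists2 phi : nat -> nat, increasing_seq phi &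
   exists2 abar : 'rV[R]_n, (forall k, 0 <= abar ord0 k <= 1) &
     alpha_bar (alpha_ (phi l)) @[l --> \oo] --> abar)
  /\
  (forall (phi : nat -> nat) (abar : 'rV[R]_n),
     increasing_seq phi ->
     (forall k, 0 <= abar ord0 k <= 1) ->
     alpha_bar (alpha_ (phi l)) @[l --> \oo] --> abar ->
   forall psi : nat -> nat, increasing_seq psi ->
   exists2 chi : nat -> nat, increasing_seq chi &
   exists xdag : X,
     [/\ x_ (phi (psi (chi l))) @[l --> \oo] --> xdag,
         F xdag = y &
         (penalty Rk abar xdag <=
           ereal_inf [set penalty Rk abar x |
                      x in [set x | joint_domain Rk x /\ F x = y]])%E]).
Proof.
move=> L K q_cvg total_cvg x_ x_min; split.
  apply: (@rV_bolzano_weierstrass _ _ (alpha_bar \o alpha_)) => l k /=.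
  by rewrite alpha_bar_ge0//= alpha_bar_le1.
move=> phi abar phii _ abar_cvg psi psii.
have phipsii := increasing_seq_comp phii psii.
have Knear := near_subseq phipsii
  (minimizers_near_sublevel Rk_ge0 S_ge0 x0D Fx0 alpha_ge0 alpha_neq0 x_min q_cvg).
have [|chi chii [xdag xdag_cvg]] := seq_coercive_pigeonhole
    (c := fun k => fine (Rk k x0) + 1) (u := x_ \o (phi \o psi)) Rk_coercive.
  apply: filterS Knear => l [k Rkx]; exists k => /=.
  by rewrite EFinD fineK// joint_domain_fin_num.
exists chi => //; exists xdag.
have rhoi := increasing_seq_comp phipsii chii.
have a_cvg : alpha_bar (alpha_ (phi (psi (chi l)))) @[l --> \oo] --> abar.
  exact: cvg_subseq (increasing_seq_comp psii chii) abar_cvg.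
split => //.
  apply: (limit_solution Rk_ge0 S_ge0 _ x0D Fx0 alpha_ge0 alpha_neq0 x_min q_cvg
    rhoi xdag_cvg (proj1 F_class) y_cvg total_cvg).
  by move=> u v /S_eq0.
apply: le_ereal_inf_tmp => _ [x [xD Fx] <-].
exact: (limit_penalty_le Rk_ge0 S_ge0 x0D Fx0 alpha_ge0 alpha_neq0 x_min q_cvg
    rhoi a_cvg xdag_cvg).
Qed.
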